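(* Let $n$ be an integer such that $n=p_1+q_1=p_2+q_2$, where $p_1,p_2,q_1,q_2$ are distinct primes. Then the prime difference graph $G_n$ contains two edge-disjoint Hamilton cycles.
   Context: For a positive integer $n$, the prime difference graph $G_n$ of order $n$ is the graph with vertex set $\{1,2,\dots,n\}$ in which two vertices $u,v$ are adjacent if and only if $|u-v|$ is a prime number. A Hamilton cycle is a cycle visiting each vertex of the graph exactly once. *)

(* Defs.v *)
From mathcomp Require Import all_boot all_order all_algebra.

Set Implicit Arguments.
Unset Strict Implicit.
Unset Printing Implicit Defensive.

(* The vertex set {1, ..., n} is encoded by 'I_n, with i : 'I_n standing for
   the integer i.+1. *)
Definition prime_diff_graph (n : nat) : rel 'I_n :=
  [rel u v : 'I_n | prime `|u.+1 - v.+1|%N].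

Lemma prime_diff_graph_sym n : symmetric (@prime_diff_graph n).
Proof. by move=> u v; rewrite /prime_diff_graph /= distnC. Qed.

Lemma prime_diff_graph_irr n : irreflexive (@prime_diff_graph n).
Proof. by move=> u; rewrite /prime_diff_graph /= distnn. Qed.

(* A cyclic sequence of pairwise distinct, consecutively adjacent vertices
   containing every vertex. The length condition excludes the degenerate
   sequences of length at most 2, which ucycle accepts but which are not
   cycles of a simple graph. *)
Definition hamilton_cycle (T : finType) (e : rel T) (c : seq T) : Prop :=
  [/\ 2 < size c, ucycle e c & forall x : T, x \in c].

Definition cycle_edges (T : finType) (c : seq T) : {set {set T}} :=
  [set [set x; next c x] | x in c].

Definition edge_disjoint (T : finType) (c1 c2 : seq T) : bool :=
  [disjoint cycle_edges c1 & cycle_edges c2].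

(* Main.v *)
Require Import Defs.
From mathcomp Require Import all_boot all_order all_algebra.
From mathcomp Require Import zify.

(** If [n = p + q] with [p] and [q] distinct primes, then [p] is coprime to
    [q], hence to [n], so the translation [x |-> x + p] of the integers modulo
    [n] is a single cycle through all the residues.  Between representatives in
    an interval of length [n], one step of this translation either adds [p] or
    subtracts [n - p = q]; in both cases the two ends differ by a prime.  The
    orbit of the translation is therefore a Hamilton cycle of the prime
    difference graph, all of whose edges have difference [p] or [q]
    ([translation_cycle]).

    Applied to two decompositions of [n] with no prime in common, this gives two
    cycles whose edges have differences in the disjoint sets [{p1, q1}] and
    [{p2, q2}].  Since the difference depends only on the unordered pair of
    ends, no edge is shared ([edge_disjoint_cycles]). *)

Definition difference_graph (D : pred nat) (n : nat) : rel 'I_n :=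
  [rel u v : 'I_n | D `|u - v|%N].

Lemma difference_graph_sym (D : pred nat) (n : nat) :
  symmetric (@difference_graph D n).
Proof. by move=> u v; rewrite /difference_graph /= distnC. Qed.

Lemma sub_ucycle {T : eqType} {e e' : rel T} {c : seq T} :
  subrel e e' -> ucycle e c -> ucycle e' c.
Proof.
move=> sub_ee' /andP[cyc_c uniq_c]; apply/andP; split=> //.
exact: sub_cycle cyc_c.
Qed.

(** Each edge of a cycle arises in only one of its two orientations, and the two
    cycles may run through a common edge in opposite directions; the symmetry
    of one relation makes the orientation irrelevant. *)
Lemma edge_disjoint_cycles {T : finType} {e1 e2 : rel T} {c1 c2 : seq T} :
    symmetric e2 -> (forall x y, e1 x y -> ~~ e2 x y) ->
  cycle e1 c1 -> cycle e2 c2 -> edge_disjoint c1 c2.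
Proof.
move=> sym_e2 disj_e cyc1 cyc2; rewrite /edge_disjoint.
apply/pred0P=> E /=; apply/andP=> -[/imsetP[x c1x ->]].
case/imsetP=> y c2y eq_edges.
have e1x := next_cycle cyc1 c1x; have e2y := next_cycle cyc2 c2y.
move: (next c1 x) (next c2 y) e1x e2y eq_edges => x' y' e1x e2y eqE.
have: y \in [set x; x'] by rewrite eqE set21.
have: y' \in [set x; x'] by rewrite eqE set22.
have: x \in [set y; y'] by rewrite -eqE set21.
have: x' \in [set y; y'] by rewrite -eqE set22.
have ne2 := disj_e _ _ e1x; have ne2' : ~~ e2 x' x by rewrite sym_e2.
rewrite !inE => /orP[]/eqP ? /orP[]/eqP ? /orP[]/eqP ? /orP[]/eqP ?; subst;
  by rewrite e2y in ne2 ne2'.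
Qed.

(** The cycle is the orbit of 0 under translation by [p] modulo [p + q].  It
    reaches a residue [y] after [y * u] steps, where [u] is an inverse of [p]
    modulo [p + q]. *)
Lemma translation_cycle {p q : nat} :
    0 < p -> coprime p q ->
  exists c : seq 'I_(p + q),
    ucycle (@difference_graph (pred2 p q) (p + q)) c /\ forall x, x \in c.
Proof.
move=> p_gt0 co_pq; have n_gt0 : 0 < p + q by rewrite addn_gt0 p_gt0.
pose shift (x : 'I_(p + q)) := Ordinal (ltn_pmod (x + p) n_gt0).
have shift_inj : injective shift.
  move=> x y /(congr1 val)/= /eqP; rewrite eqn_modDr !modn_small // => /eqP.
  exact: val_inj.
have iter_shift k x : iter k shift x = (x + k * p) %% (p + q) :> nat.
  elim: k => [|k IHk] /=; first by rewrite mul0n addn0 modn_small.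
  by rewrite IHk modnDml -addnA -mulSnr.
pose x0 := Ordinal n_gt0; exists (orbit shift x0); split.
  apply: (@sub_ucycle _ (frel shift)); last first.
    by rewrite /ucycle cycle_orbit ?orbit_uniq.
  move=> x _ /eqP <-; rewrite /difference_graph /=.
  have lt_xn := ltn_ord x.
  (* The translation wraps around exactly when [x + p] reaches [p + q]. *)
  case: (ltnP (x + p) (p + q)) => [lt_n | ge_n]; first by rewrite modn_small; lia.
  have ->: (x + p) %% (p + q) = x - q.
    have {1}->: x + p = x - q + (p + q) by lia.
    by rewrite modnDr modn_small //; lia.
  by lia.
move=> y; rewrite -fconnect_orbit.
have co_pn : coprime p (p + q) by rewrite /coprime gcdnDl.
case: (egcdnP (p + q) p_gt0) => u v def_u _.
suff ->: y = iter (y * u) shift x0 by apply: fconnect_iter.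
apply: val_inj; rewrite /= iter_shift /= add0n -mulnA def_u (eqP co_pn).
by rewrite mulnDr muln1 mulnA modnMDl modn_small.
Qed.

Lemma hamilton_difference_cycle {n p q : nat} :
    prime p -> prime q -> p != q -> n = p + q ->
  exists2 c : seq 'I_n, hamilton_cycle (@prime_diff_graph n) c
                      & cycle (@difference_graph (pred2 p q) n) c.
Proof.
move=> pr_p pr_q neq_pq ->.
have co_pq : coprime p q by rewrite prime_coprime // dvdn_prime2.
have [c [ucyc_c c_full]] := translation_cycle (prime_gt0 pr_p) co_pq.
exists c; last exact: ucycle_cycle ucyc_c.
split=> //; last first.
  apply: sub_ucycle ucyc_c => u v.
  rewrite /prime_diff_graph /difference_graph /=.
  rewrite -[u.+1]addn1 -[v.+1]addn1 distnDr.
  by case/orP=> /eqP->.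
have <-: #|'I_(p + q)| = size c.
  rewrite -(card_uniqP (ucycle_uniq ucyc_c)).
  by apply: eq_card => x; rewrite c_full.
have := prime_gt1 pr_p; have := prime_gt1 pr_q; rewrite card_ord; lia.
Qed.

Theorem corollary4p5 (n p1 q1 p2 q2 : nat)
    (hp1 : prime p1) (hq1 : prime q1) (hp2 : prime p2) (hq2 : prime q2)
    (hdistinct : uniq [:: p1; q1; p2; q2])
    (hn1 : n = p1 + q1) (hn2 : n = p2 + q2) :
  exists c1 c2 : seq 'I_n,
    [/\ hamilton_cycle (@prime_diff_graph n) c1,
        hamilton_cycle (@prime_diff_graph n) c2
      & edge_disjoint c1 c2].
Proof.
have [neq1 neq2] : p1 != q1 /\ p2 != q2.
  by move: hdistinct; rewrite /= !inE; lia.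
have [c1 ham1 cyc1] := hamilton_difference_cycle hp1 hq1 neq1 hn1.
have [c2 ham2 cyc2] := hamilton_difference_cycle hp2 hq2 neq2 hn2.
exists c1, c2; split=> //.
apply: edge_disjoint_cycles cyc1 cyc2; first exact: difference_graph_sym.
move=> x y; rewrite /difference_graph /=; move: hdistinct; rewrite /= !inE.
by case/and3P=> h1 h2 _ /orP[]/eqP->; lia.
Qed.
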